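(* Let $Y_{r,n}(0)$ be the $0$-Yokonuma-Hecke algebra over $\mathbb{K}$. All simple $Y_{r,n}(0)$-modules are of dimension $1$ over $\mathbb{K}$. Moreover, the isomorphism classes of simple $Y_{r,n}(0)$-modules are indexed by (i.e. are in bijection with) the set $$\big\{(\mathrm{c},\mathrm{J})=((c_1,\ldots,c_n),(J_1,\ldots,J_k))\ \big|\ \mathrm{c}\in C^n \text{ and } J_j \text{ is a composition of } |(I_{\mathrm{c}})_j| \text{ for } 1\le j\le k\big\},$$ where $C=\{1,\ldots,r\}$ and, for each $\mathrm{c}$, $k$ is the number of blocks of $I_{\mathrm{c}}=((I_{\mathrm{c}})_1,\ldots,(I_{\mathrm{c}})_k)$.
   Context: Let $r,n\ge 1$ be integers and let $\mathbb{K}$ be an algebraically closed field of characteristic $p\ge 0$ such that $p$ does not divide $r$. The $0$-Yokonuma-Hecke algebra $Y_{r,n}(0)$ is the associative unital $\mathbb{K}$-algebra generated by $t_1,\ldots,t_n,g_1,\ldots,g_{n-1}$ subject to the relations: $t_i^r=1$ for $1\le i\le n$; $t_it_j=t_jt_i$ for $1\le i,j\le n$; $g_it_j=t_{s_i(j)}g_i$ for $1\le i\le n-1$, $1\le j\le n$, where $s_i$ is the transposition $(i,i+1)$; $g_ig_j=g_jg_i$ for $1\le i,j\le n-1$ with $|i-j|\ge 2$; $g_ig_{i+1}g_i=g_{i+1}g_ig_{i+1}$ for $1\le i\le n-2$; and $g_i^2=-e_ig_i$ for $1\le i\le n-1$, where $e_i:=\frac1r\sum_{s=0}^{r-1}t_i^st_{i+1}^{-s}$.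 For $\mathrm{c}=(c_1,\ldots,c_n)\in C^n$ with $C=\{1,\ldots,r\}$, the sequence $I_{\mathrm{c}}=((I_{\mathrm{c}})_1,\ldots,(I_{\mathrm{c}})_k)$ is the decomposition of $\mathrm{c}$ into maximal constant consecutive blocks: there are $0=i_0<i_1<\cdots<i_k=n$ with $(I_{\mathrm{c}})_j=(c_{i_{j-1}+1},\ldots,c_{i_j})$, $c_{i_{j-1}+1}=\cdots=c_{i_j}$ for $1\le j\le k$, and $c_{i_j}\ne c_{i_j+1}$ for $1\le j\le k-1$. Put $|(I_{\mathrm{c}})_j|=i_j-i_{j-1}$. A composition of a positive integer $m$ is a finite sequence of positive integers with sum $m$. *)

(* Defs.v *)
From HB Require Import structures.
From mathcomp Require Import all_boot all_fingroup all_algebra.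
From mathcomp Require Import finmap generic_quotient ring_quotient boolp.
From mathcomp.multinomials Require Import monalg.

Set Implicit Arguments.
Unset Strict Implicit.
Unset Printing Implicit Defensive.

Import GRing.Theory.
Local Open Scope ring_scope.
Local Open Scope quotient_scope.

(* {malg K[{fmonom X}]} is the free associative unital K-algebra on X. *)
Lemma malg_scalerAr (K : fieldType) (X : choiceType) (k : K)
    (x y : {malg K[{fmonom X}]}) :
  k *: (x * y) = x * (k *: y).
Proof.
apply/malgP=> m; rewrite mcoeffZ [in LHS]mcoeffMl.
rewrite (mcoeffMlw _ (fsubset_refl _) (msuppZ_le k y)) mulr_sumr.
apply: eq_bigr => i _; rewrite mulr_sumr; apply: eq_bigr => j _.
by rewrite mcoeffZ mulrnAr mulrCA.
Qed.

Section IdealQuotient.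
Variables (K : fieldType) (A : lalgType K).
Hypothesis scalerArA : forall (k : K) (x y : A), k *: (x * y) = x * (k *: y).
Variable S : A -> Prop.

Definition two_sided_ideal (I : A -> Prop) :=
  [/\ I 0, forall x y, I x -> I y -> I (x - y)
    & forall a x b, I x -> I (a * x * b)].

Definition gen_ideal : {pred A} := fun x =>
  `[< forall I, two_sided_ideal I -> (forall s, S s -> I s) -> I x >].

Lemma gen_idealP x :
  reflect (forall I, two_sided_ideal I -> (forall s, S s -> I s) -> I x)
          (x \in gen_ideal).
Proof. exact: asboolP. Qed.

Lemma gen_ideal_zmod : zmod_closed gen_ideal.
Proof.
split=> [|x y /gen_idealP Ix /gen_idealP Iy]; apply/gen_idealP => I II SI.
  by case: II.
by case: (II) => _ IB _; apply: IB; [apply: Ix | apply: Iy].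
Qed.

HB.instance Definition _ := GRing.isZmodClosed.Build A gen_ideal gen_ideal_zmod.

Lemma gen_idealM a x b : x \in gen_ideal -> a * x * b \in gen_ideal.
Proof.
move=> /gen_idealP Ix; apply/gen_idealP => I II SI.
by case: (II) => _ _; apply; apply: Ix.
Qed.

Lemma mem_gen_ideal s : S s -> s \in gen_ideal.
Proof. by move=> Ss; apply/gen_idealP => I _; apply. Qed.

Definition alg_quot : Type := Quotient.quot gen_ideal.

HB.instance Definition _ := GRing.Zmodule.copy alg_quot (Quotient.quot gen_ideal).

Implicit Types (x y : A) (u v w : alg_quot).

Definition alg_quot_pi x : alg_quot := \pi_(Quotient.quot gen_ideal) x.
Definition alg_quot_repr u : A := repr (u : Quotient.quot gen_ideal).
Local Notation pi := alg_quot_pi.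
Local Notation rep := alg_quot_repr.

Lemma alg_quot_reprK u : pi (rep u) = u.
Proof. exact: reprK. Qed.

Lemma alg_quot_ind (P : alg_quot -> Prop) : (forall x, P (pi x)) -> forall u, P u.
Proof. by move=> Ppi u; rewrite -(alg_quot_reprK u). Qed.

Lemma alg_quot_eq x y : pi x = pi y <-> x - y \in gen_ideal.
Proof. by rewrite Quotient.idealrBE; split=> [/eqP|/eqP]. Qed.

Lemma alg_quot_pi0 : pi 0 = 0.
Proof. by rewrite /pi piE. Qed.

Lemma alg_quot_piD x y : pi (x + y) = pi x + pi y.
Proof. by rewrite /pi !piE. Qed.

Definition alg_quot_mul u v : alg_quot := pi (rep u * rep v).
Definition alg_quot_scale (k : K) u : alg_quot := pi (k *: rep u).

Lemma repr_pi x : rep (pi x) - x \in gen_ideal.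
Proof. by apply/alg_quot_eq; rewrite alg_quot_reprK. Qed.

Lemma alg_quot_piM x y : pi (x * y) = alg_quot_mul (pi x) (pi y).
Proof.
apply/esym/alg_quot_eq; set x' := rep _; set y' := rep _.
have -> : x' * y' - x * y = 1 * (x' - x) * y' + x * (y' - y) * 1.
  by rewrite mul1r mulr1 mulrBl mulrBr addrA subrK.
by rewrite rpredD // gen_idealM // repr_pi.
Qed.

Lemma alg_quot_piZ k x : pi (k *: x) = alg_quot_scale k (pi x).
Proof.
apply/esym/alg_quot_eq; set x' := rep _.
have -> : k *: x' - k *: x = k%:A * (x' - x) * 1.
  by rewrite mulr1 mulr_algl scalerBr.
by rewrite gen_idealM // repr_pi.
Qed.

Lemma alg_quot_mulA : associative alg_quot_mul.
Proof.
elim/alg_quot_ind=> x; elim/alg_quot_ind=> y; elim/alg_quot_ind=> z.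
by rewrite -!alg_quot_piM mulrA.
Qed.

Lemma alg_quot_mul1r : left_id (pi 1) alg_quot_mul.
Proof. by elim/alg_quot_ind=> x; rewrite -!alg_quot_piM mul1r. Qed.

Lemma alg_quot_mulr1 : right_id (pi 1) alg_quot_mul.
Proof. by elim/alg_quot_ind=> x; rewrite -!alg_quot_piM mulr1. Qed.

Lemma alg_quot_mulDl : left_distributive alg_quot_mul +%R.
Proof.
elim/alg_quot_ind=> x; elim/alg_quot_ind=> y; elim/alg_quot_ind=> z.
by rewrite -!(alg_quot_piD, alg_quot_piM) mulrDl.
Qed.

Lemma alg_quot_mulDr : right_distributive alg_quot_mul +%R.
Proof.
elim/alg_quot_ind=> x; elim/alg_quot_ind=> y; elim/alg_quot_ind=> z.
by rewrite -!(alg_quot_piD, alg_quot_piM) mulrDr.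
Qed.

Lemma alg_quot_scalerA a b v :
  alg_quot_scale a (alg_quot_scale b v) = alg_quot_scale (a * b) v.
Proof. by elim/alg_quot_ind: v => x; rewrite -!alg_quot_piZ scalerA. Qed.

Lemma alg_quot_scale1r : left_id 1 alg_quot_scale.
Proof. by elim/alg_quot_ind=> x; rewrite -!alg_quot_piZ scale1r. Qed.

Lemma alg_quot_scalerDr : right_distributive alg_quot_scale +%R.
Proof.
move=> a; elim/alg_quot_ind=> x; elim/alg_quot_ind=> y.
by rewrite -!(alg_quot_piD, alg_quot_piZ) scalerDr.
Qed.

Lemma alg_quot_scalerDl v : {morph alg_quot_scale^~ v : a b / a + b}.
Proof.
elim/alg_quot_ind: v => x a b.
by rewrite -!alg_quot_piZ -alg_quot_piD scalerDl.
Qed.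

Lemma alg_quot_scalerAl a u v :
  alg_quot_scale a (alg_quot_mul u v) = alg_quot_mul (alg_quot_scale a u) v.
Proof.
elim/alg_quot_ind: u => x; elim/alg_quot_ind: v => y.
by rewrite -!(alg_quot_piZ, alg_quot_piM) scalerAl.
Qed.

Lemma alg_quot_scalerAr a u v :
  alg_quot_scale a (alg_quot_mul u v) = alg_quot_mul u (alg_quot_scale a v).
Proof.
elim/alg_quot_ind: u => x; elim/alg_quot_ind: v => y.
by rewrite -!(alg_quot_piZ, alg_quot_piM) scalerArA.
Qed.

End IdealQuotient.

Section Yokonuma.
Variables (K : fieldType) (r n : nat).

Definition posl (i : 'I_n.-1) : 'I_n := widen_ord (leq_pred n) i.
Lemma posr_proof (i : 'I_n.-1) : (i.+1 < n)%N.
Proof. by rewrite -ltn_predRL. Qed.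
Definition posr (i : 'I_n.-1) : 'I_n := Ordinal (posr_proof i).

Definition yh_free := {malg K[{fmonom ('I_n + 'I_n.-1)%type}]}.

Definition free_t (i : 'I_n) : yh_free := << fmu (inl i) >>.
Definition free_g (i : 'I_n.-1) : yh_free := << fmu (inr i) >>.

(* The free algebra has no inverse of t_{i+1}; modulo t_{i+1}^r = 1, the
   power t_{i+1}^{-s} is t_{i+1}^{r-s} for s <= r. *)
Definition free_e (i : 'I_n.-1) : yh_free :=
  r%:R^-1 *: \sum_(0 <= s < r) free_t (posl i) ^+ s * free_t (posr i) ^+ (r - s).

Local Notation t := free_t.
Local Notation g := free_g.
Local Notation e := free_e.

Inductive yh_relator : yh_free -> Prop :=
| YH_t_order i : yh_relator (t i ^+ r - 1)
| YH_t_comm i j : yh_relator (t i * t j - t j * t i)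
| YH_g_t i j : yh_relator (g i * t j - t (tperm (posl i) (posr i) j) * g i)
| YH_g_comm (i j : 'I_n.-1) : (i + 2 <= j)%N || (j + 2 <= i)%N ->
    yh_relator (g i * g j - g j * g i)
| YH_g_braid (i j : 'I_n.-1) : j = i.+1 :> nat ->
    yh_relator (g i * g j * g i - g j * g i * g j)
| YH_g_quad i : yh_relator (g i ^+ 2 - (- (e i * g i))).

Definition YH0 : Type := alg_quot yh_relator.
Definition yh_pi (x : yh_free) : YH0 := alg_quot_pi yh_relator x.

(* The algebra structures exclude the zero ring: YH0 is nonzero because of the
   character t_i |-> 1, g_i |-> 0. *)
Definition aug_monom (m : {fmonom ('I_n + 'I_n.-1)%type}) : K :=
  (all (fun x => if x is inl _ then true else false) (m : seq _))%:R.

Lemma aug_monom_morph : mmorphism aug_monom.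
Proof.
split=> [x y|]; last by rewrite /aug_monom fm1.
by rewrite /aug_monom fmM all_cat; do 2!case: all; rewrite /= ?mulr0 ?mul0r ?mulr1.
Qed.

HB.instance Definition _ :=
  monalg.isMultiplicative.Build _ _ aug_monom aug_monom_morph.

Lemma yh_character : exists f : yh_free -> K,
  [/\ f 1 = 1, {morph f : x y / x - y}, {morph f : x y / x * y},
      forall i, f (t i) = 1 & forall i, f (g i) = 0].
Proof.
exists (mmap idfun aug_monom); split.
- exact: rmorph1.
- exact: rmorphB.
- exact: rmorphM.
- by move=> i; rewrite mmapU /aug_monom fmU mul1r.
- by move=> i; rewrite mmapU /aug_monom fmU mulr0.
Qed.

Lemma one_notin_ideal : 1 \notin gen_ideal yh_relator.
Proof.
have [f [f1 fB fM ft fg]] := yh_character.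
apply/negP => /gen_idealP /(_ (fun x => f x = 0)).
rewrite f1 => idf; apply/(elimN eqP (oner_neq0 K))/idf.
  split=> [|y z y0 z0|a y b y0]; first by rewrite -(subrr 0) fB subrr.
    by rewrite fB y0 z0 subrr.
  by rewrite !fM y0 mulr0 mul0r.
have fBM u v w x : f (u * v - w * x) = f u * f v - f w * f x.
  by apply: etrans (fB _ _) _; congr (_ - _); exact: fM.
have fC u v : f (u * v - v * u) = 0 by rewrite fBM mulrC subrr.
have fX u k : f (u ^+ k) = f u ^+ k.
  by elim: k => [|k IHk]; rewrite ?expr0 // !exprS fM IHk.
have ft1 u : f u = 1 -> f (u ^+ r - 1) = 0.
  by move=> u1; rewrite fB fX u1 expr1n f1 subrr.
have fgt u v w : f u = 0 -> f (u * v - w * u) = 0.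
  by move=> u0; rewrite fBM u0 mul0r mulr0 subrr.
have fgg u v : f u = 0 -> f (u * v * u - v * u * v) = 0.
  by move=> u0; rewrite fBM u0 mulr0 sub0r fM u0 mulr0 mul0r oppr0.
have fg2 u v : f u = 0 -> f (u ^+ 2 - (- (v * u))) = 0.
  by move=> u0; rewrite opprK -mulrDl fM u0 mulr0.
move=> s; case=> [i|i j|i j|i j _|i j _|i].
- exact/ft1/ft.
- exact: fC.
- exact/fgt/fg.
- exact: fC.
- exact/fgg/fg.
- exact/fg2/fg.
Qed.

HB.instance Definition _ := GRing.Zmodule.copy YH0 (alg_quot yh_relator).

Lemma YH0_1neq0 : alg_quot_pi yh_relator 1 != 0 :> YH0.
Proof.
apply/eqP; rewrite -(alg_quot_pi0 yh_relator) => /alg_quot_eq.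
by rewrite subr0; apply/negP; exact: one_notin_ideal.
Qed.

HB.instance Definition _ := GRing.Zmodule_isNzRing.Build YH0
  (@alg_quot_mulA _ _ yh_relator) (@alg_quot_mul1r _ _ yh_relator)
  (@alg_quot_mulr1 _ _ yh_relator) (@alg_quot_mulDl _ _ yh_relator)
  (@alg_quot_mulDr _ _ yh_relator) YH0_1neq0.

HB.instance Definition _ := GRing.Zmodule_isLmodule.Build K YH0
  (@alg_quot_scalerA _ _ yh_relator) (@alg_quot_scale1r _ _ yh_relator)
  (@alg_quot_scalerDr _ _ yh_relator) (@alg_quot_scalerDl _ _ yh_relator).

HB.instance Definition _ := GRing.Lmodule_isLalgebra.Build K YH0
  (@alg_quot_scalerAl _ _ yh_relator).

HB.instance Definition _ := GRing.Lalgebra_isAlgebra.Build K YH0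
  (@alg_quot_scalerAr _ _ (@malg_scalerAr _ _) yh_relator).
End Yokonuma.

Section Modules.
Variables (K : fieldType) (A : algType K).

Definition restrict_scalars (M : lmodType A) : Type := M.

HB.instance Definition _ (M : lmodType A) :=
  GRing.Zmodule.copy (restrict_scalars M) M.

Section RestrictScalars.
Variable M : lmodType A.

Definition restrict_scale (k : K) (v : restrict_scalars M) :
  restrict_scalars M := k%:A *: (v : M).

Fact restrict_scalerA a b v :
  restrict_scale a (restrict_scale b v) = restrict_scale (a * b) v.
Proof. by rewrite /restrict_scale scalerA mulr_algl scalerA. Qed.

Fact restrict_scale1r : left_id 1 restrict_scale.
Proof. by move=> v; rewrite /restrict_scale !scale1r. Qed.

Fact restrict_scalerDr : right_distributive restrict_scale +%R.
Proof. by move=> a u v; exact: scalerDr. Qed.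

Fact restrict_scalerDl v : {morph restrict_scale^~ v : a b / a + b}.
Proof. by move=> a b; rewrite /restrict_scale !scalerDl. Qed.

HB.instance Definition _ := GRing.Zmodule_isLmodule.Build K (restrict_scalars M)
  restrict_scalerA restrict_scale1r restrict_scalerDr restrict_scalerDl.
End RestrictScalars.

Definition has_dim (M : lmodType A) (d : nat) : Prop :=
  inhabited (Vector.axiom d (restrict_scalars M)).

Definition simple_module (M : lmodType A) : Prop :=
  (exists v : M, v != 0) /\
  forall S : {pred M}, GRing.submod_closed S ->
    (forall v, v \in S -> v = 0) \/ (forall v, v \in S).

Definition module_iso (M N : lmodType A) : Prop :=
  exists f : {linear M -> N}, bijective f.

End Modules.

Section Blocks.
Variable T : eqType.

Fixpoint const_blocks (c : seq T) : seq (seq T) :=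
  if c is x :: c' then
    match const_blocks c' with
    | (y :: B) :: Bs =>
        if x == y then (x :: y :: B) :: Bs else [:: x] :: (y :: B) :: Bs
    | Bs => [:: x] :: Bs
    end
  else [::].

(* const_blocks c is the decomposition of c into maximal constant blocks. *)
Lemma const_blocksP c :
  [/\ flatten (const_blocks c) = c,
      all (fun B => (B != [::]) && constant B) (const_blocks c)
    & sorted (fun B B' => ~~ constant (B ++ B')) (const_blocks c)].
Proof.
elim: c => //= x c [].
case: (const_blocks c) => [|[|y B] Bs] //= <-; first by [].
move=> /andP[cB aB] sB; case: eqVneq => [->|xy] /=; last first.
  by rewrite cB aB sB eq_sym (negPf xy).
by rewrite eqxx cB aB; split=> //; case: Bs aB sB => //= B' Bs _; rewrite eqxx.
Qed.
End Blocks.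

Definition is_composition (m : nat) (J : seq nat) : bool :=
  all (leq 1) J && (sumn J == m).

(* Colours are 'I_r = {0, ..., r-1} instead of {1, ..., r}. *)
Definition yh_index_pred r n (x : n.-tuple 'I_r * seq (seq nat)) : bool :=
  all2 (fun (J : seq nat) (B : seq 'I_r) => is_composition (size B) J)
    x.2 (const_blocks x.1).

Definition yh_index (r n : nat) : Type :=
  {x : n.-tuple 'I_r * seq (seq nat) | yh_index_pred x}.

(* Main.v *)
Require Import Defs.
From HB Require Import structures.
From mathcomp Require Import all_boot all_fingroup all_algebra.
From mathcomp Require Import cyclic separable cyclotomic boolp zify.
From mathcomp.multinomials Require Import monalg.
Set Implicit Arguments.
Unset Strict Implicit.
Unset Printing Implicit Defensive.
Import GRing.Theory.
Local Open Scope ring_scope.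

(** A simple module is a line because every nonzero module contains a common
    eigenvector of all the generators.  The t_i commute and satisfy t^r = 1,
    where 'X^r - 1 splits, so they have a common eigenvector, called a weight
    vector.  Each g_i sends weight vectors to weight vectors, and e_i acts on
    a weight vector by a scalar, so on weight vectors g_i satisfies a
    quadratic relation g_i^2 = k g_i with k in K.  A common eigenvector of
    g_0, ..., g_m is then found by induction on m: if v is one for
    g_0, ..., g_(m-1), the last nonzero vector in the chain v, g_m v,
    g_(m-1) g_m v, ... is one for g_0, ..., g_m (braid_eigenvector).
    In effect this finds an element w of maximal length such that g_w v is
    nonzero, one coset of a parabolic subgroup at a time.

    It remains to classify the algebra morphisms from Y_{r,n}(0) to K.  Fix a
    primitive r-th root of unity z; it exists because r is invertible in K.
    A character sends t_i to z^(c_i) for a unique tuple c of colours.  It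
    sends g_i to 0 if c_i and c_(i+1) differ, by the relation between g_i and
    t_i, and to 0 or -1 if they are equal, because e_i is then sent to 1.
    Conversely, every such choice of values respects the defining relations.
    So characters correspond to pairs (c, D), where D is a set of
    positions i with c_i = c_(i+1), the positions where g_i is sent to -1.

    Such a D is the same as a choice of a composition of the size of each
    constant block of c: cut the block after each position in D.  To make
    this precise, a list of compositions is encoded by the bit sequence of
    length n that marks the last position of each part (block_ends).  The bit
    sequences obtained are those that mark the end of every block of c
    (marks_breaks), and the encoding is injective; the bits inside the blocks
    are free and give D.

    The argument uses only the presentation of Y_{r,n}(0): the relations, the
    generation by the t_i and g_i, and the existence of characters with
    prescribed values.  It is therefore carried out for any algebra with this
    presentation (yokonuma_hecke0), to which the quotient of the free
    algebra is specialized at the end. *)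

(** * Compositions of blocks as bit sequences *)

Section BitEncoding.
Local Open Scope nat_scope.

(** The bit sequence 0..010..01... with one run per part, whose ones sit at
    the last positions of the parts. *)
Definition part_ends (J : seq nat) : bitseq :=
  flatten [seq rcons (nseq m.-1 false) true | m <- J].

Definition block_ends (Js : seq (seq nat)) : bitseq :=
  flatten [seq part_ends J | J <- Js].

(** The last bit is forced to be set, as [ohead c'] is then [None]. *)
Fixpoint marks_breaks (T : eqType) (c : seq T) (b : bitseq) : bool :=
  match c, b with
  | [::], [::] => true
  | x :: c', d :: b' => (d || (ohead c' == Some x)) && marks_breaks c' b'
  | _, _ => false
  end.

Lemma part_ends_cons m J :
  part_ends (m :: J) = rcons (nseq m.-1 false) true ++ part_ends J.
Proof. by []. Qed.

Lemma part_endsS m J : 0 < m ->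
  part_ends (m.+1 :: J) = false :: part_ends (m :: J).
Proof. by case: m. Qed.

Lemma size_part_ends J : all (leq 1) J -> size (part_ends J) = sumn J.
Proof.
elim: J => //= m J IH /andP[m_gt0 /IH sz].
by rewrite part_ends_cons size_cat size_rcons size_nseq prednK // sz.
Qed.

Lemma part_ends_inj J J' : all (leq 1) J -> all (leq 1) J' ->
  part_ends J = part_ends J' -> J = J'.
Proof.
elim: J J' => [|m J IH] [|m' J'] //=; rewrite ?part_ends_cons.
- by move=> _ _ /esym; case: m'.-1.
- by move=> _ _; case: m.-1.
move=> /andP[m_gt0 J_gt0] /andP[m'_gt0 J'_gt0].
rewrite -(prednK m_gt0) -(prednK m'_gt0) /= => eqJ.
suff [-> /(IH _ J_gt0 J'_gt0) ->] :
  m.-1 = m'.-1 /\ part_ends J = part_ends J' by [].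
elim: (m.-1) (m'.-1) eqJ => [|k IHk] [|k'] //= [] // /IHk [-> ->] //.
Qed.

Lemma is_composition1 J : is_composition 1 J -> J = [:: 1].
Proof.
case: J => [|[|[|m]] [|m' J]] //; rewrite /is_composition /=; first by lia.
by rewrite andbF.
Qed.

Section Blocks.
Variable T : eqType.
Implicit Types (c : seq T) (Js : seq (seq nat)).

Definition compositions_of Js (Bs : seq (seq T)) :=
  all2 (fun J B => is_composition (size B) J) Js Bs.

(** Extracts single bits, so that they can be compared with the values of a
    character at the corresponding generators. *)
Lemma marks_breaks_nth x0 c b : marks_breaks c b <->
  size b = size c /\
  forall i, i < size c ->
    nth false b i || ((i.+1 < size c) && (nth x0 c i == nth x0 c i.+1)).
Proof.
elim: c b => [|x c IH] [|d b] /=; [by split|by split=> [|[]]|by split=> [|[]]|].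
have -> : (ohead c == Some x) = (0 < size c) && (x == nth x0 c 0).
  by case: c {IH} => //= y c; apply/eqP/eqP => [[->]|->].
split=> [/andP[d1 /IH[-> H]]|[[sz] H]].
  by split=> // [[|i]] //=; exact: H.
apply/andP; split; first exact: (H 0).
by apply/IH; split=> // i; exact: (H i.+1).
Qed.

(** By recursion on the colours: a new first colour either starts a new block,
    or extends the first block; in the latter case its bit decides whether it
    forms a new part or extends the first part. *)
Lemma block_ends_exist c b : marks_breaks c b ->
  exists2 Js, compositions_of Js (const_blocks c) & block_ends Js = b.
Proof.
elim: c b => [|x c IH] [|d b] //=; first by exists [::].
case/andP=> d_ok /IH[Js Js_c <-]; have [fc ac _] := const_blocksP c.
case: (const_blocks c) Js Js_c fc ac => [|[|y B] Bs] [|J Js] //=.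
  by move=> _ cE _; move: d_ok; rewrite -cE orbF /= => ->; exists [:: [:: 1]].
case/andP=> Jy Jsc cE _; move: d_ok; rewrite -cE /=.
have -> : (Some y == Some x) = (x == y).
  by rewrite eq_sym; apply/eqP/eqP => [[->]|->].
case: eqP => [<-|_]; last first.
  rewrite orbF => ->; exists ([:: 1] :: J :: Js) => //=; exact/andP.
case: d => _.
  exists ((1 :: J) :: Js) => //=; rewrite Jsc andbT.
  by move: Jy; rewrite /is_composition /= add1n eqSS.
case: J Jy => [|m J]; first by rewrite /is_composition.
rewrite /is_composition => /=/andP[/andP[m_gt0 J_gt0] Jy].
exists ((m.+1 :: J) :: Js) => /=.
  by rewrite Jsc /is_composition /= J_gt0 addSn eqSS Jy.
by rewrite /block_ends /= part_endsS.
Qed.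

Lemma marks_breaks_block_ends c Js :
  compositions_of Js (const_blocks c) -> marks_breaks c (block_ends Js).
Proof.
elim: c Js => [|x c IH] [|J Js] //=.
  by case: (const_blocks c) => [|[|y B] Bs] //; case: eqP.
have [fc ac _] := const_blocksP c.
case: (const_blocks c) IH fc ac => [|[|y B] Bs] //= IH cE _.
  by case: Js => [|J' Js] /andP[// /is_composition1 -> _]; rewrite -cE.
have hd : (ohead c == Some x) = (x == y).
  by rewrite -cE /= eq_sym; apply/eqP/eqP => [[->]|->].
case: (eqVneq x y) hd => [<-|_] hd /andP[] //.
  case: J => [|m J]; rewrite /is_composition //=.
  case/andP=> /andP[m_gt0 J_gt0] sJ Jsc.
  case: m m_gt0 sJ => [|[|m]] // _ sJ.
    apply: (IH (J :: Js)).
    by rewrite /= Jsc andbT /is_composition J_gt0 -eqSS.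
  rewrite /= hd; apply: (IH ((m.+1 :: J) :: Js)) => /=.
  by rewrite Jsc andbT /is_composition /= J_gt0 -eqSS.
by move/is_composition1=> -> /IH.
Qed.

(** The sizes of the blocks are determined by the colours, so the flattened
    bit sequence can be cut into the bit sequences of the blocks. *)
Lemma block_ends_inj c Js Js' :
  compositions_of Js (const_blocks c) -> compositions_of Js' (const_blocks c) ->
  block_ends Js = block_ends Js' -> Js = Js'.
Proof.
have shapeE Bs Ks : compositions_of Ks Bs -> shape (map part_ends Ks) = shape Bs.
  elim: Ks Bs => [|J Ks IH] [|B Bs] //= /andP[/andP[J_gt0 /eqP sJ] /IH ->].
  by rewrite size_part_ends // sJ.
have pos Bs Ks : compositions_of Ks Bs -> all (all (leq 1)) Ks.
  by elim: Ks Bs => [|J Ks IH] [|B Bs] //= /andP[/andP[-> _] /IH].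
move=> cJ cJ' eqJ.
have := eq_from_flatten_shape eqJ
  (etrans (shapeE _ _ cJ) (esym (shapeE _ _ cJ'))).
elim: Js Js' {eqJ cJ cJ'} (pos _ _ cJ) (pos _ _ cJ') => [|J Js IH] [|J' Js'] //=.
move=> /andP[J0 Js0] /andP[J'0 Js'0] [eqJ /(IH _ Js0 Js'0) ->].
by rewrite (part_ends_inj J0 J'0 eqJ).
Qed.
End Blocks.

End BitEncoding.

(** * Eigenvectors of braid operators *)

Section Eigenvectors.
Variables (K : fieldType) (A : algType K) (M : lmodType A).
Implicit Types (a b : A) (u v : M) (k : K).

Lemma scaleA_comm k a v : a *: (k%:A *: v) = k%:A *: (a *: v).
Proof. by rewrite !scalerA mulr_algl mulr_algr. Qed.

(** The scalar is taken in K and not in A, so that the a with [eigen u a] form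
    a subalgebra acting on u through a character. *)
Definition eigen u a := exists k, a *: u = k%:A *: u.

Lemma eigen1 u : eigen u 1.
Proof. by exists 1; rewrite !scale1r. Qed.

Lemma eigenD u a b : eigen u a -> eigen u b -> eigen u (a + b).
Proof. by move=> [k ak] [l bl]; exists (k + l); rewrite !scalerDl ak bl. Qed.

Lemma eigenZ u k a : eigen u a -> eigen u (k *: a).
Proof.
move=> [l al]; exists (k * l).
by rewrite -(mulr_algl k a) -(scalerA k%:A a) al scalerA mulr_algl scalerA.
Qed.

Lemma eigenM u a b : eigen u a -> eigen u b -> eigen u (a * b).
Proof.
move=> [k ak] [l bl]; exists (k * l).
by rewrite -scalerA bl scaleA_comm ak !scalerA !mulr_algl scalerA mulrC.
Qed.

Lemma eigen_transfer u a b :  GRing.comm a b -> eigen u a -> eigen (b *: u) a.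
Proof.
by move=> ab [k ak]; exists k; rewrite scalerA ab -scalerA ak scaleA_comm.
Qed.

(** The eigenvector is the last nonzero partial product applied to v.  It lies
    in the orbit of v under polynomials in a, so whatever commutes with a and
    has v as an eigenvector keeps it as an eigenvector. *)
Lemma split_eigenvector a (zs : seq K) v : v != 0 ->
    (\prod_(z <- zs) (a - z%:A)) *: v = 0 ->
  exists z b, [/\ z \in zs, b *: v != 0, a *: (b *: v) = z%:A *: (b *: v)
    & forall a', GRing.comm a' a -> GRing.comm a' b].
Proof.
move=> v0; elim: zs => [|z zs IH].
  by rewrite big_nil scale1r => /eqP; rewrite (negPf v0).
rewrite big_cons -scalerA; set b := \prod_(_ <- _) _.
have [/IH[z' [b' [z'zs]]] | bv0] := eqVneq (b *: v) 0.
  by move=> ? ? ? _; exists z', b'; rewrite inE z'zs orbT.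
move/eqP; rewrite scalerBl subr_eq0 => /eqP abv.
exists z, b; split=> // [|a' a'a]; first exact: mem_head.
rewrite /b; elim/big_rec: _ => [|y x _ a'x]; first exact: commr1.
apply: commrM => //; apply: commrB => //.
by rewrite /GRing.comm mulr_algl mulr_algr.
Qed.

Section Braid.
Variable g : nat -> A.
Hypothesis g_comm : forall i j, (i + 2 <= j)%N -> GRing.comm (g i) (g j).
Hypothesis g_braid : forall i, g i * g i.+1 * g i = g i.+1 * g i * g i.+1.

(** The product g_(m-l+1) ... g_(m-1) g_m with l factors, a minimal coset
    representative of the parabolic subgroup generated by the first m
    reflections. *)
Fixpoint descend m l : A :=
  if l is l'.+1 then g (m - l') * descend m l' else 1.

Lemma descend_comm m l i : (i + l < m)%N -> GRing.comm (g i) (descend m l).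
Proof.
elim: l => [|l IH] il /=; first exact: commr1.
by apply: commrM; [apply: g_comm; lia | apply: IH; lia].
Qed.

(** Here g_i and g_(i+1) both occur in the product, and one braid relation
    moves g_(i+1) to the right, where it comes out as g_i. *)
Lemma descend_shift m l i : (l <= m.+1)%N -> (i < m < i + l)%N ->
  g i.+1 * descend m l = descend m l * g i.
Proof.
elim: l => [|l IH] lm /andP[im il] /=; first by lia.
have [il'|il'] := ltnP m (i + l).
  rewrite mulrA -(g_comm (i := (m - l)%N)); last lia.
  by rewrite -!mulrA IH ?im // ltnW.
have -> : (m - l = i)%N by lia.
case: l {IH} lm il il' => [|l] lm il il' /=; first by lia.
have -> : (m - l = i.+1)%N by lia.
rewrite !mulrA -g_braid -!mulrA.
by rewrite -descend_comm //; lia.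
Qed.

Variable W : M -> Prop.
Hypothesis W_g : forall i u, W u -> W (g i *: u).
Hypothesis g_quad : forall i u, W u -> eigen (g i *: u) (g i).

(** With l maximal such that [descend m l *: v] is nonzero, g_i acts on this
    vector as on v if i < m - l, by zero if i = m - l (maximality), by the
    quadratic relation if i = m - l + 1, and as g_(i-1) does on v if i is
    larger. *)
Lemma braid_eigenvector m v : W v -> v != 0 ->
  exists u, [/\ W u, u != 0 & forall i, (i < m)%N -> eigen u (g i)].
Proof.
move=> Wv v0; elim: m => [|m [{v0 Wv}v [Wv v0 v_eig]]]; first by exists v.
pose x := descend m.
have Wx l : W (x l *: v).
  by elim: l => [|l IH] /=; rewrite ?scale1r // -scalerA; exact: W_g.
have [l [lm xl0 last_l]] : exists l, [/\ (l <= m.+1)%N, x l *: v != 0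
    & (l <= m)%N -> x l.+1 *: v = 0].
  suff: forall l, (l <= m.+1)%N -> x l *: v != 0 \/
      exists k : nat, [/\ (k <= m)%N, x k *: v != 0 & x k.+1 *: v = 0].
    case/(_ m.+1 (leqnn _)) => [x0|[k [km xk xk1]]].
      by exists m.+1; rewrite ltnn.
    by exists k; rewrite leqW.
  elim=> [|l IH] lm; first by left; rewrite scale1r.
  have [xl|] := IH (ltnW lm); last by right.
  by have [|xl1] := eqVneq (x l.+1 *: v) 0; [right; exists l | left].
exists (x l *: v); split=> // i im.
have [il|il] := ltnP (i + l) m.
  by apply: eigen_transfer; [exact: descend_comm | apply: v_eig; lia].
have [il1|il1] := ltnP m (i + l); last first.
  exists 0; rewrite !scale0r scalerA.
  have -> : i = (m - l)%N by lia.
  by apply: last_l; lia.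
case: l lm {xl0 last_l} il il1 => [|l] lm il il1; first by lia.
have [il2|il2] := ltnP m (i + l); last first.
  have -> : i = (m - l)%N by lia.
  by rewrite /x /= -scalerA; exact: g_quad.
case: i im il il1 il2 => [|i] im il il1 il2; first by exfalso; lia.
have [k vk] := v_eig i im; exists k.
by rewrite scalerA descend_shift; [rewrite -scalerA vk scaleA_comm | lia..].
Qed.
End Braid.
End Eigenvectors.

(** * One-dimensional modules *)

Section CharModule.
Variables (K : fieldType) (A : algType K).

Definition char_module (chi : {lrmorphism A -> K^o}) : Type := K.

Section Structure.
Variable chi : {lrmorphism A -> K^o}.

HB.instance Definition _ := GRing.Zmodule.copy (char_module chi) K.

Definition char_scale (a : A) (x : char_module chi) : char_module chi :=
  (chi a : K) * x.

Fact char_scalerA a b x : char_scale a (char_scale b x) = char_scale (a * b) x.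
Proof. by rewrite /char_scale rmorphM mulrA. Qed.

Fact char_scale1r : left_id 1 char_scale.
Proof. by move=> x; rewrite /char_scale rmorph1 mul1r. Qed.

Fact char_scalerDr : right_distributive char_scale +%R.
Proof. by move=> a x y; exact: mulrDr. Qed.

Fact char_scalerDl x : {morph char_scale^~ x : a b / a + b}.
Proof. by move=> a b; rewrite /char_scale rmorphD mulrDl. Qed.

HB.instance Definition _ := GRing.Zmodule_isLmodule.Build A (char_module chi)
  char_scalerA char_scale1r char_scalerDr char_scalerDl.

Lemma char_moduleE (a : A) (x : char_module chi) :
  a *: x = (chi a : K) * (x : K) :> K.
Proof. by []. Qed.

Lemma character_const k : chi k%:A = k.
Proof. by rewrite linearZ /= rmorph1; exact: mulr1. Qed.

Lemma char_module_simple : simple_module (char_module chi).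
Proof.
split; first by exists (1 : K); exact: oner_neq0.
move=> S [S0 S_lin].
have [[x [Sx x0]]|none] := pselect (exists x, x \in S /\ x != 0); [right|left].
  move=> y; have := S_lin ((y : K) / x)%:A x 0 Sx S0.
  by rewrite addr0 char_moduleE character_const divfK.
by move=> v Sv; apply/eqP/negPn/negP => v0; apply: none; exists v.
Qed.
End Structure.

(** A scalar of A acts by the same scalar of K on both sides, so an
    isomorphism transports the action of each element. *)
Lemma char_module_iso chi psi :
  module_iso (char_module chi) (char_module psi) -> chi =1 psi.
Proof.
case=> f /bij_inj f_inj a.
pose e : char_module chi := (1 : K).
have fe0 : (f e : K) != 0.
  apply/eqP => fe0; have : e = 0 by apply: f_inj; rewrite linear0.
  by apply/eqP; exact: oner_neq0.
have fZ b x : f (b *: x) = b *: f x by exact: linearZ.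
apply: (mulIf fe0); rewrite -[RHS]char_moduleE -fZ.
have -> : a *: e = (chi a : K)%:A *: e.
  by rewrite !char_moduleE character_const.
by rewrite fZ char_moduleE character_const.
Qed.

Section Coordinates.
Variables (M : lmodType A) (u : M).
Hypotheses (M_simple : simple_module M) (u0 : u != 0).
Hypothesis u_eig : forall a, eigen u a.

Lemma scale_inj (k l : K) : k%:A *: u = l%:A *: u -> k = l.
Proof.
move=> kl; apply/eqP; rewrite -subr_eq0; apply: contraNT u0 => kl0.
rewrite -(scale1r u) -(scale1r (1 : A)) -(mulVf kl0) -scalerA -mulr_algl -scalerA.
by rewrite scalerBl scalerBl kl subrr scaler0.
Qed.

(** The line through u is stable under A, hence is the whole module. *)
Lemma simple_coordinate : exists coord : M -> K, forall v, v = (coord v)%:A *: u.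
Proof.
suff /choice[coord coordE] : forall v, exists k : K, v = k%:A *: u.
  by exists coord.
move=> v.
have [] := M_simple.2 (fun w => `[< exists k : K, w = k%:A *: u >]).
- split=> [|a _ _ /asboolP[k ->] /asboolP[l ->]]; apply/asboolP.
    by exists 0; rewrite !scale0r.
  have [m am] := u_eig a; exists (m * k + l).
  by rewrite scaleA_comm am scalerDl scalerDl scalerA mulr_algl scalerA mulrC.
- move/(_ u)=> u_eq0; case/eqP: u0; apply: u_eq0.
  by apply/asboolP; exists 1; rewrite !scale1r.
by move=> /(_ v) /asboolP.
Qed.

Lemma simple_dim1 : has_dim M 1.
Proof.
have [coord coordE] := simple_coordinate; constructor.
exists (fun v => (coord v)%:M : 'rV[K]_1).
  move=> k v w; apply/rowP => i; rewrite !mxE ord1 eqxx !mulr1n.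
  apply: scale_inj; rewrite -coordE scalerDl scalerDl -coordE -scalerA -mulr_algl.
  by rewrite -(scalerA (_%:A)) -coordE.
exists (fun x : 'rV[K]_1 => (x 0 0)%:A *: u).
  by move=> v; rewrite mxE eqxx -coordE.
move=> x; apply/rowP => i; rewrite !mxE ord1 eqxx mulr1n.
by apply: scale_inj; rewrite -coordE.
Qed.

Lemma eigen_character : exists chi : {lrmorphism A -> K^o},
  forall a, a *: u = (chi a : K)%:A *: u.
Proof.
have [chi chiE] := boolp.choice u_eig.
have chi_lin : linear (chi : A -> K^o).
  move=> k a b; apply: scale_inj; rewrite -chiE !scalerDl -chiE; congr (_ + _).
  by rewrite -(mulr_algl k a) -(scalerA k%:A a u) chiE scalerA mulr_algl scalerA.
have chi_mul : monoid_morphism (chi : A -> K^o).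
  split=> [|a b]; apply: scale_inj; rewrite -chiE; first by rewrite !scale1r.
  by rewrite -scalerA (chiE b) scaleA_comm chiE scalerA mulr_algl scalerA mulrC.
pose chiL := GRing.isLinear.Build K A K^o _ chi chi_lin.
pose chiM := GRing.isMonoidMorphism.Build A K^o chi chi_mul.
by exists (HB.pack chi chiL chiM : {lrmorphism A -> K^o}).
Qed.

Lemma simple_char_iso (chi : {lrmorphism A -> K^o}) :
  (forall a, a *: u = (chi a : K)%:A *: u) -> module_iso M (char_module chi).
Proof.
have [coord coordE] := simple_coordinate => u_chi.
pose f (v : M) : char_module chi := coord v.
have f_lin : linear f.
  move=> a v w; apply: scale_inj; rewrite -coordE.
  rewrite scalerDl scalerDl -[f w]/(coord w) -coordE; congr (_ + w).
  by rewrite char_moduleE -scalerA -mulr_algl -(scalerA _%:A) -coordE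
     {1}(coordE v) scaleA_comm u_chi scaleA_comm -coordE.
pose fL := GRing.isLinear.Build A M (char_module chi) _ f f_lin.
exists (HB.pack f fL : {linear M -> char_module chi}) => /=.
exists (fun k : K => k%:A *: u) => [v|k]; first by rewrite -coordE.
by apply: scale_inj; rewrite -coordE.
Qed.
End Coordinates.
End CharModule.

(** * The presentation and its weight vectors *)

(** The value of e_i under a character with values x and y at t_i and t_(i+1).
    If x and y are equal, all r terms of the sum are 1; otherwise the sum
    vanishes, because its product by x - y is y (x^r - y^r) = 0. *)
Lemma geometric_indicator (K : fieldType) (r : nat) (x y : K) :
    r%:R != 0 :> K -> x ^+ r = 1 -> y ^+ r = 1 ->
  r%:R^-1 * \sum_(0 <= s < r) x ^+ s * y ^+ (r - s) = (x == y)%:R.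
Proof.
move=> r0 xr yr; have [<-|xy] := eqVneq x y.
  under eq_big_nat => s /andP[_ sr] do rewrite -exprD subnKC 1?ltnW // xr.
  by rewrite big_const_nat subn0 iter_addr_0 mulVf.
rewrite (_ : \sum_(_ <= _ < _) _ = 0) ?mulr0 //.
have : (y - x) * (\sum_(s < r) y ^+ (r.-1 - s) * x ^+ s) = 0.
  by rewrite -subrXX xr yr subrr.
move/eqP; rewrite mulf_eq0 subr_eq0 eq_sym (negPf xy) /= => /eqP sum0.
transitivity (y * 0); last exact: mulr0.
rewrite -[in RHS]sum0 mulr_sumr big_mkord; apply: eq_bigr => s _.
rewrite mulrA -exprS mulrC; congr (y ^+ _ * _).
by have := ltn_ord s; lia.
Qed.

Lemma closed_prim_root (K : closedFieldType) (r : nat) :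
  (0 < r)%N -> r%:R != 0 :> K -> exists z : K, r.-primitive_root z.
Proof.
move=> r_gt0 r0; have [rs] := closed_field_poly_normal ('X^r - 1 : {poly K}).
rewrite lead_coefXnsubC // scale1r => rsE.
have rs_unity : all r.-unity_root rs.
  by apply/allP => z; rewrite -root_prod_XsubC -rsE.
have rs_uniq : uniq rs.
  by rewrite -separable_prod_XsubC -rsE; exact: separable_Xn_sub_1.
have rs_size : (r <= size rs)%N.
  by rewrite -ltnS -(size_prod_XsubC rs id) -rsE size_XnsubC.
have /hasP[z _ z_prim] := has_prim_root r_gt0 rs_unity rs_uniq rs_size.
by exists z.
Qed.

Definition yh_idempotent (K : fieldType) (A : algType K) (r n : nat)
    (t : 'I_n -> A) (i : 'I_n.-1) : A :=
  r%:R^-1 *: (\sum_(0 <= s < r) t (posl i) ^+ s * t (posr i) ^+ (r - s)).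

(** The last field is the universal property of the presentation, for
    morphisms to K only. *)
Record yokonuma_hecke0 (K : fieldType) (r n : nat) (A : algType K)
    (t : 'I_n -> A) (g : 'I_n.-1 -> A) : Prop := YokonumaHecke0 {
  t_order : forall i, t i ^+ r = 1;
  t_comm : forall i j, GRing.comm (t i) (t j);
  g_t : forall i j, g i * t j = t (tperm (posl i) (posr i) j) * g i;
  g_comm : forall i j : 'I_n.-1, (i + 2 <= j)%N -> GRing.comm (g i) (g j);
  g_braid : forall i j : 'I_n.-1, j = i.+1 :> nat ->
    g i * g j * g i = g j * g i * g j;
  g_quad : forall i, g i ^+ 2 = - (yh_idempotent r t i * g i);
  generation_ind : forall P : A -> Prop, P 1 ->
    (forall a b, P a -> P b -> P (a + b)) ->
    (forall k a, P a -> P (k *: a)) ->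
    (forall a b, P a -> P b -> P (a * b)) ->
    (forall i, P (t i)) -> (forall i, P (g i)) -> forall a, P a;
  character_exists : forall (phi : 'I_n -> K) (gamma : 'I_n.-1 -> K),
    (forall i, phi i ^+ r = 1) ->
    (forall i j,
       gamma i * phi j = phi (tperm (posl i) (posr i) j) * gamma i) ->
    (forall i j, gamma i * gamma j * gamma i = gamma j * gamma i * gamma j) ->
    (forall i, gamma i ^+ 2 = - (r%:R^-1 *
       (\sum_(0 <= s < r) phi (posl i) ^+ s * phi (posr i) ^+ (r - s))
       * gamma i)) ->
    exists chi : {lrmorphism A -> K^o},
      (forall i, chi (t i) = phi i) /\ (forall i, chi (g i) = gamma i)
}.

Section Weights.
Variables (K : fieldType) (r n : nat) (A : algType K).
Variables (t : 'I_n -> A) (g : 'I_n.-1 -> A).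
Hypothesis AP : yokonuma_hecke0 r t g.
Variable z : K.
Hypothesis z_prim : r.-primitive_root z.
Variable M : lmodType A.
Implicit Types (u v : M).

Lemma t_split i :
  \prod_(x <- [seq z ^+ k | k <- index_iota 0 r]) (t i - x%:A) = 0 :> A.
Proof.
rewrite big_map.
have := congr1 (horner_alg (t i)) (factor_Xn_sub_1 z_prim).
rewrite rmorph_prod rmorphB rmorphXn /= horner_algX rmorph1 (t_order AP) subrr.
move=> prodE; rewrite -[RHS]prodE; apply: eq_bigr => k _.
by rewrite rmorphB /= horner_algX horner_algC.
Qed.

Definition weight_vector u := forall i, eigen u (t i).

(** One t_i at a time: an eigenvector of the next one is found among the
    images of u under operators that commute with all the t_i. *)
Lemma weight_vector_exists v : v != 0 -> exists2 u : M, u != 0 & weight_vector u.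
Proof.
move=> v0; suff: forall m, exists2 u : M,
    u != 0 & forall i : 'I_n, (i < m)%N -> eigen u (t i).
  by case/(_ n)=> u u0 u_eig; exists u => // i; exact: u_eig.
elim=> [|m [u u0 u_eig]]; first by exists v.
have [nm|mn] := leqP n m.
  by exists u => // i _; apply: u_eig; exact: leq_trans (ltn_ord i) nm.
pose i0 := Ordinal mn.
have /(split_eigenvector u0)[x [b [_ b0 xb b_comm]]] :
    \prod_(x <- [seq z ^+ k | k <- index_iota 0 r]) (t i0 - x%:A) *: u = 0.
  by rewrite t_split scale0r.
exists (b *: u) => // i; rewrite ltnS leq_eqVlt => /predU1P[im|im].
  by exists x; have -> : i = i0 by exact: val_inj.
by apply: eigen_transfer (u_eig i im); apply: b_comm; exact: t_comm AP _ _.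
Qed.

Lemma eigenX u a m : eigen u a -> eigen u (a ^+ m).
Proof.
by move=> ua; elim: m => [|m IH]; [exact: eigen1 | rewrite exprS; exact: eigenM].
Qed.

Lemma weight_e u i : weight_vector u -> eigen u (yh_idempotent r t i).
Proof.
move=> uW; apply: eigenZ; elim/big_rec: _ => [|s a _ ua].
  by rewrite -(scale0r 1); exact/eigenZ/eigen1.
by apply: eigenD => //; apply: eigenM; apply: eigenX.
Qed.

(** g_i exchanges the eigenvalues of t_i and t_(i+1). *)
Lemma weight_g u i : weight_vector u -> weight_vector (g i *: u).
Proof.
move=> uW j; have [k uk] := uW (tperm (posl i) (posr i) j); exists k.
rewrite -[j in LHS](tpermK (posl i) (posr i)) scalerA -(g_t AP).
by rewrite -scalerA uk scaleA_comm.
Qed.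

Lemma yokonuma_eigenvector v : v != 0 -> exists u : M,
  [/\ u != 0, forall i, eigen u (t i) & forall i, eigen u (g i)].
Proof.
move=> /weight_vector_exists[{}v v0 vW].
(* With the value 0 outside the range of indices, the braid and commutation
   relations hold for all natural numbers. *)
pose g' (k : nat) : A := if insub k is Some i then g i else 0.
have g'E (i : 'I_n.-1) : g' i = g i by rewrite /g' valK.
have g'P (k : nat) : (exists i : 'I_n.-1, k = i :> nat) \/ g' k = 0.
  by rewrite /g'; case: insubP => [i _ <-|]; [left; exists i | right].
have g'_comm (i j : nat) : (i + 2 <= j)%N -> GRing.comm (g' i) (g' j).
  case: (g'P i) => [[{}i ->]|->]; last by move=> _; exact/commr_sym/commr0.
  case: (g'P j) => [[{}j ->]|->]; last by move=> _; exact/commr0.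
  by rewrite !g'E; exact: g_comm AP _ _.
have g'_braid (i : nat) : g' i * g' i.+1 * g' i = g' i.+1 * g' i * g' i.+1.
  case: (g'P i) => [[{}i ->]|->]; last by rewrite !(mul0r, mulr0).
  case: (g'P i.+1) => [[j ij]|->]; last by rewrite !(mul0r, mulr0).
  by rewrite ij !g'E; exact: g_braid AP _ _ (esym ij).
have W_g' k u : weight_vector u -> weight_vector (g' k *: u).
  move=> uW; case: (g'P k) => [[i ->]|->]; first by rewrite g'E; exact: weight_g.
  by move=> j; exists 0; rewrite !scale0r scaler0.
have g'_quad k u : weight_vector u -> eigen (g' k *: u) (g' k).
  move=> uW; case: (g'P k) => [[i ->]|->]; last by exists 0; rewrite !scale0r.
  rewrite g'E; have [x xE] := weight_e i (weight_g i uW); exists (- x).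
  by rewrite scalerA -expr2 (g_quad AP) scaleNr -scalerA xE scaleNr scaleNr.
have [u [uW u0 u_eig]] :=
  braid_eigenvector g'_comm g'_braid W_g' g'_quad n.-1 vW v0.
by exists u; split=> // i; rewrite -g'E; apply: u_eig; exact: ltn_ord.
Qed.
End Weights.

(** * Characters and their indices *)

Section Classification.
Variables (K : closedFieldType) (r n : nat) (A : algType K).
Variables (t : 'I_n -> A) (g : 'I_n.-1 -> A).
Hypothesis AP : yokonuma_hecke0 r t g.
Hypotheses (r_gt0 : (0 < r)%N) (r0 : r%:R != 0 :> K).
Variable z : K.
Hypothesis z_prim : r.-primitive_root z.
Implicit Types (c : n.-tuple 'I_r) (x y : yh_index r n).
Implicit Types chi psi : {lrmorphism A -> K^o}.

Definition t_value c (i : 'I_n) : K := z ^+ tnth c i.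

(** The bit of a position is disregarded when the colours differ: there it is
    set because a block ends, and g_i must act by zero. *)
Definition g_value c (b : bitseq) (i : 'I_n.-1) : K :=
  - (nth false b i && (tnth c (posl i) == tnth c (posr i)))%:R.

Definition has_index chi x :=
  (forall i, chi (t i) = t_value (val x).1 i) /\
  (forall i, chi (g i) = g_value (val x).1 (block_ends (val x).2) i).

Lemma prim_root_inj (i j : 'I_r) : (z ^+ i == z ^+ j) = (i == j).
Proof. by rewrite (eq_prim_root_expr z_prim) !modn_small. Qed.

(** The values at the g_i are 0 or -1, so the braid relation, which reads
    x^2 y = x y^2 in K, holds for them. *)
Lemma character_of_index x : exists chi, has_index chi x.
Proof.
case: x => -[c Js] xP; set b := block_ends Js.
have t_r (i : 'I_n) : t_value c i ^+ r = 1.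
  by rewrite /t_value exprAC (prim_expr_order z_prim) expr1n.
have [|||chi chiP] :=
  character_exists AP (phi := t_value c) (gamma := g_value c b) t_r.
- move=> i j; rewrite /g_value.
  case: (nth _ _ _) => /=; last by rewrite oppr0 mulr0 mul0r.
  case: eqP => [ci|_]; last by rewrite oppr0 mulr0 mul0r.
  by rewrite mulrC /t_value; case: tpermP => [->|->|//]; rewrite ci.
- move=> i j; rewrite /g_value; do 2 case: (_ && _) => //=.
    by rewrite oppr0 !(mulr0, mul0r).
  by rewrite oppr0 !(mulr0, mul0r).
- move=> i; rewrite (geometric_indicator r0) ?t_r // prim_root_inj /g_value.
  case: (nth _ _ _); case: eqP => _ /=.
  - by rewrite mul1r sqrrN expr1n opprK.
  - by rewrite !oppr0 mulr0 expr0n oppr0.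
  - by rewrite !oppr0 mulr0 expr0n oppr0.
  - by rewrite !oppr0 mulr0 expr0n oppr0.
by exists chi.
Qed.

(** The relation of g_i with t_i and the quadratic relation force the value at
    g_i to be 0 or -1, and to be 0 where the colour changes. *)
Lemma index_of_character chi : exists x, has_index chi x.
Proof.
pose v (a : A) : K := chi a.
have vM a b : v (a * b) = v a * v b by exact: rmorphM.
have vX a m : v (a ^+ m) = v a ^+ m by exact: rmorphXn.
have v_r i : v (t i) ^+ r = 1 by rewrite -vX (t_order AP); exact: rmorph1.
have [c cE] := boolp.choice
  (fun i => ex_intro _ _ (svalP (prim_rootP z_prim (v_r i)))).
pose c' := [tuple c i | i < n].
have c'E i : tnth c' i = c i by rewrite tnth_mktuple.
have v_eq i j : (v (t i) == v (t j)) = (c i == c j).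
  by rewrite !cE prim_root_inj.
have g0 i : c (posl i) != c (posr i) -> v (g i) = 0.
  rewrite -v_eq => cc; have := congr1 v (g_t AP i (posl i)).
  rewrite tpermL !vM mulrC => /eqP; rewrite -subr_eq0 -mulrBl mulf_eq0 subr_eq0.
  by rewrite (negPf cc) => /eqP.
have g_bit i : v (g i) = - (v (g i) == -1)%:R.
  have [->|g1] := eqVneq; first by [].
  rewrite oppr0; have [cc|/g0//] := eqVneq (c (posl i)) (c (posr i)).
  have := congr1 v (g_quad AP i).
  have -> u : v (- u) = - v u by exact: rmorphN.
  rewrite vX vM.
  have -> k u : v (k *: u) = k * v u by rewrite /v linearZ.
  have -> : v (\sum_(0 <= s < r) t (posl i) ^+ s * t (posr i) ^+ (r - s))
    = \sum_(0 <= s < r) v (t (posl i)) ^+ s * v (t (posr i)) ^+ (r - s).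
    rewrite {1}/v rmorph_sum; apply: eq_bigr => s _.
    by rewrite -!vX -vM.
  rewrite (geometric_indicator r0) // v_eq cc eqxx mul1r => /eqP.
  rewrite -addr_eq0 expr2 -{3}[v (g i)]mul1r -mulrDl mulf_eq0 addr_eq0 (negPf g1).
  by move/eqP.
(* Bits are set at the ends of blocks and where g_i is sent to -1. *)
pose b := mkseq (fun k : nat => if insub k is Some i then
  (v (g i) == -1) || (c (posl i) != c (posr i)) else true) n.
have x0 : 'I_r := Ordinal r_gt0.
have c_nth (i : 'I_n) : nth x0 c' i = c i by rewrite -tnth_nth c'E.
have b_i (i : 'I_n.-1) :
    nth false b i = (v (g i) == -1) || (c (posl i) != c (posr i)).
  by rewrite nth_mkseq ?valK //; exact: ltn_ord (posl i).
have bP : marks_breaks c' b.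
  apply/(marks_breaks_nth x0); rewrite size_mkseq size_tuple; split=> // k kn.
  have [kn1|nk] := ltnP k.+1 n; last first.
    by rewrite nth_mkseq //; case: insubP => // i ik _; lia.
  have kn1' : (k < n.-1)%N by lia.
  have := b_i (Ordinal kn1'); rewrite /= => ->.
  have := c_nth (posl (Ordinal kn1')); have := c_nth (posr (Ordinal kn1')).
  rewrite /= => -> ->.
  by rewrite -orbA orNb orbT.
have [Js JsP JsE] := block_ends_exist bP.
pose x : yh_index r n := exist (fun w => yh_index_pred w) (c', Js) JsP.
exists x; split=> i; first by rewrite /= /t_value c'E; exact: cE.
rewrite /= /g_value JsE b_i !c'E.
have [cc|cc] := eqVneq (c (posl i)) (c (posr i)).
  by rewrite orbF andbT; exact: g_bit.
by rewrite andbF oppr0; exact: g0.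
Qed.

(** The values at the g_i determine the bits inside the blocks; the others are
    set for both indices. *)
Lemma has_index_inj chi x y : has_index chi x -> has_index chi y -> x = y.
Proof.
case: x y => [[c Js] xP] [[c' Js'] yP] [/= tx gx] [/= ty gy].
apply: val_inj => /=.
have cc' : c = c'.
  apply: eq_from_tnth => i; apply/eqP; rewrite -prim_root_inj; apply/eqP.
  by have := tx i; rewrite ty.
subst c'; congr (_, _).
have x0 : 'I_r := Ordinal r_gt0.
have /(marks_breaks_nth x0)[sJ bJ] := marks_breaks_block_ends xP.
have /(marks_breaks_nth x0)[sJ' bJ'] := marks_breaks_block_ends yP.
apply: (block_ends_inj xP yP); apply: (eq_from_nth (x0 := false)) => [|k].
  by rewrite sJ sJ'.
rewrite /= in sJ sJ' bJ bJ' *.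
rewrite sJ => kc; have := bJ k kc; have := bJ' k kc.
case: (boolP (_ && _)) => [/andP[k1c /eqP ck] _ _|_]; last first.
  by rewrite !orbF => -> ->.
rewrite size_tuple in kc k1c.
have kn1 : (k < n.-1)%N by lia.
pose i := Ordinal kn1.
have ci : tnth c (posl i) == tnth c (posr i) by rewrite !(tnth_nth x0) /= ck.
have := gx i; rewrite gy /g_value ci !andbT /= => /oppr_inj.
do 2 case: nth => //=; move/eqP; first by rewrite oner_eq0.
by rewrite eq_sym oner_eq0.
Qed.

Lemma has_index_eq chi psi x : has_index chi x -> has_index psi x -> chi =1 psi.
Proof.
move=> [tx gx] [ty gy].
apply: (generation_ind AP (P := fun a => chi a = psi a)).
- by rewrite !rmorph1.
- by move=> a b aE bE; rewrite !rmorphD /= aE bE.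
- by move=> k a aE; rewrite !linearZ /= aE.
- by move=> a b aE bE; rewrite !rmorphM /= aE bE.
- by move=> i; rewrite tx ty.
- by move=> i; rewrite gx gy.
Qed.

Lemma simple_eigenvector (M : lmodType A) : simple_module M ->
  exists2 u : M, u != 0 & forall a, eigen u a.
Proof.
case=> -[v v0] _; have [u [u0 ut ug]] := yokonuma_eigenvector AP z_prim v0.
exists u => //; apply: (generation_ind AP (P := eigen u)) => // [|a b|k a|a b].
- exact: eigen1.
- exact: eigenD.
- exact: eigenZ.
- exact: eigenM.
Qed.

Theorem simple_classification :
  (forall M : lmodType A, simple_module M -> has_dim M 1) /\
  (exists L : yh_index r n -> lmodType A,
    [/\ forall x, simple_module (L x),
        forall x y, module_iso (L x) (L y) -> x = y
      & forall M : lmodType A, simple_module M ->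
          exists x, module_iso M (L x)]).
Proof.
split=> [M Ms|].
  by have [u u0 u_eig] := simple_eigenvector Ms; exact: simple_dim1 u_eig.
have [chi chiP] := boolp.choice character_of_index.
exists (fun x => char_module (chi x)); split=> [x|x y|M Ms].
- exact: char_module_simple.
- move/char_module_iso => xy; apply: has_index_inj (chiP x) _.
  by case: (chiP y) => ty gy; split=> i; rewrite xy ?ty ?gy.
have [u u0 u_eig] := simple_eigenvector Ms.
have [psi psiE] := eigen_character u0 u_eig.
have [x xP] := index_of_character psi; exists x.
apply: (simple_char_iso Ms u0 u_eig) => a.
by rewrite (has_index_eq (chiP x) xP).
Qed.
End Classification.

(** * The quotient of the free algebra *)

(** The multiplication of the quotient is kept as [alg_quot_mul], since the
    quotient of a general algebra may be zero. *)
Section QuotientRelations.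
Variables (K : fieldType) (A : lalgType K) (S : A -> Prop).
Local Notation pi := (@alg_quot_pi K A S).
Local Notation mul := (@alg_quot_mul K A S).

Lemma alg_quot_rel x y : S (x - y) -> pi x = pi y.
Proof. by move=> Sxy; apply/alg_quot_eq/mem_gen_ideal. Qed.

Lemma alg_quot_relM a b c d : S (a * b - c * d) ->
  mul (pi a) (pi b) = mul (pi c) (pi d).
Proof. by move=> /alg_quot_rel; rewrite !alg_quot_piM. Qed.

Lemma alg_quot_relM3 a b c d e f : S (a * b * c - d * e * f) ->
  mul (mul (pi a) (pi b)) (pi c) = mul (mul (pi d) (pi e)) (pi f).
Proof. by move=> /alg_quot_rel; rewrite !alg_quot_piM. Qed.

End QuotientRelations.

Section CharacterRelations.
Variables (K : fieldType) (A : lalgType K) (f : {lrmorphism A -> K^o}).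

Lemma character_relX a m : (f a : K) ^+ m = 1 -> f (a ^+ m - 1) = 0.
Proof. by move=> am; rewrite rmorphB rmorphXn rmorph1 [f a ^+ m]am subrr. Qed.

Lemma character_relM a b c d : (f a : K) * f b = f c * f d ->
  f (a * b - c * d) = 0.
Proof. by move=> eqf; rewrite rmorphB !rmorphM /= [f a * _]eqf subrr. Qed.

Lemma character_relM3 a b c d e g : (f a : K) * f b * f c = f d * f e * f g ->
  f (a * b * c - d * e * g) = 0.
Proof. by move=> eqf; rewrite rmorphB !rmorphM /= [f a * _ * _]eqf subrr. Qed.

Lemma character_rel_quad (c : K) m x y z :
  (f z : K) ^+ 2 = - (c * (\sum_(0 <= s < m) f x ^+ s * f y ^+ (m - s)) * f z) ->
  f (z ^+ 2 - - (c *: (\sum_(0 <= s < m) x ^+ s * y ^+ (m - s)) * z)) = 0.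
Proof.
move=> eqf; set w := \sum_(0 <= s < m) x ^+ s * y ^+ _.
have fw : f w = \sum_(0 <= s < m) f x ^+ s * f y ^+ (m - s).
  rewrite rmorph_sum; apply: eq_bigr => s _.
  by rewrite rmorphM !rmorphXn.
have fcw : f (c *: w) = c * f w by exact: linearZ.
rewrite rmorphB rmorphXn rmorphN rmorphM /= fcw fw.
by rewrite [f z ^+ 2]eqf subrr.
Qed.
End CharacterRelations.

Lemma lrmorph_quad (K : fieldType) (A B : lalgType K) (f : {lrmorphism A -> B})
    (c : K) m (x y z : A) :
  f (z ^+ 2) = f (- (c *: (\sum_(0 <= s < m) x ^+ s * y ^+ (m - s)) * z)) ->
  f z ^+ 2 = - (c *: (\sum_(0 <= s < m) f x ^+ s * f y ^+ (m - s)) * f z).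
Proof.
rewrite rmorphXn => ->; rewrite rmorphN rmorphM /= linearZ rmorph_sum /=.
congr (- (_ *: _ * _)); apply: eq_bigr => s _.
by rewrite rmorphM !rmorphXn.
Qed.

Section FreeAlgebra.
Variables (K : fieldType) (X : choiceType).
Local Notation free := {malg K[{fmonom X}]}.
Local Notation gen x := (<< fmu x >> : free).

Lemma free_ind (P : free -> Prop) :
    P 1 -> (forall a b, P a -> P b -> P (a + b)) ->
    (forall k a, P a -> P (k *: a)) -> (forall a b, P a -> P b -> P (a * b)) ->
    (forall x, P (gen x)) ->
  forall a, P a.
Proof.
move=> P1 PD PZ PM Pgen a.
have Pm (m : {fmonom X}) : P << m >>.
  case: m => s; elim: s => [|y s IH]; first by rewrite -fmoneE.
  have -> : FMonom (y :: s) = mmul (fmu y) (FMonom s).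
    by apply/eqP; rewrite -val_eqE /= fmM fmU.
  have -> : << mmul (fmu y) (FMonom s) >> = gen y * << FMonom s >>.
    by rewrite malgM_def fgmulUU mulr1.
  exact: PM.
rewrite [a]monalgE; elim/big_ind: _ => // [|m _].
  by rewrite -(scale0r 1); exact: PZ.
have -> : << a@_m *g m >> = a@_m *: << m >> :> free.
  by rewrite -mul_malgC malgM_def fgmulUU mulr1 mul1m.
exact: PZ.
Qed.

Definition monom_val (v : X -> K) (m : {fmonom X}) : K :=
  \prod_(x <- (m : seq X)) v x.

Lemma monom_val_mmorphism v : mmorphism (monom_val v).
Proof. by split=> [x y|]; rewrite /monom_val ?fmM ?fm1 ?big_cat ?big_nil. Qed.

HB.instance Definition _ v :=
  monalg.isMultiplicative.Build _ _ (monom_val v) (monom_val_mmorphism v).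

Lemma free_character (v : X -> K) :
  exists f : {lrmorphism free -> K^o}, forall x, f (gen x) = v x.
Proof.
pose f : free -> K^o := mmap idfun (monom_val v).
have fZ k a : f (k *: a) = k *: f a by exact: (mmapZ (f := idfun)).
have f_lin : linear f by move=> k a b; rewrite -fZ; exact: rmorphD.
have f_mul : monoid_morphism f.
  by split=> [|a b]; [exact: rmorph1 | exact: rmorphM].
pose fL := GRing.isLinear.Build K free K^o _ f f_lin.
pose fM := GRing.isMonoidMorphism.Build free K^o f f_mul.
exists (HB.pack f fL fM : {lrmorphism free -> K^o}) => x.
by rewrite /= /f mmapU /= mul1r /monom_val fmU big_seq1.
Qed.
End FreeAlgebra.

(** The elements killed by f form a two-sided ideal, which contains the ideal
    generated by S as soon as it contains S. *)
Lemma alg_quot_lift (K : fieldType) (A : lalgType K) (S : A -> Prop)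
    (f : {lrmorphism A -> K^o}) : (forall x, S x -> f x = 0) ->
  exists h : alg_quot S -> K^o,
    [/\ forall x, h (alg_quot_pi S x) = f x,
        forall k u v, h (alg_quot_scale k u + v) = k * h u + h v
      & forall u v, h (alg_quot_mul u v) = h u * h v].
Proof.
move=> fS.
have f_ideal x : x \in gen_ideal S -> f x = 0.
  move=> /gen_idealP /(_ (fun y => f y = 0)); apply=> //.
  split=> [|y z y0 z0|a y b y0]; first exact: rmorph0.
    by rewrite rmorphB /= y0 z0 subrr.
  by rewrite !rmorphM /= y0 mulr0 mul0r.
have fpi x : f (alg_quot_repr (alg_quot_pi S x)) = f x.
  by apply/eqP; rewrite -subr_eq0 -rmorphB; apply/eqP/f_ideal/repr_pi.
exists (fun u => f (alg_quot_repr u)); split=> //.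
  move=> k; elim/alg_quot_ind=> x; elim/alg_quot_ind=> y.
  by rewrite -alg_quot_piZ -alg_quot_piD !fpi linearP.
elim/alg_quot_ind=> x; elim/alg_quot_ind=> y.
by rewrite -alg_quot_piM !fpi rmorphM.
Qed.

Section Presentation.
Variables (K : fieldType) (r n : nat).

Lemma yh_pi_is_linear : linear (@yh_pi K r n).
Proof. by move=> k x y; rewrite /yh_pi alg_quot_piD alg_quot_piZ. Qed.

HB.instance Definition _ :=
  GRing.isLinear.Build K (yh_free K n) (YH0 K r n) _ (@yh_pi K r n)
    yh_pi_is_linear.

Lemma yh_pi_is_monoid_morphism : monoid_morphism (@yh_pi K r n).
Proof. by split=> [//|x y]; exact: alg_quot_piM. Qed.

HB.instance Definition _ :=
  GRing.isMonoidMorphism.Build (yh_free K n) (YH0 K r n) (@yh_pi K r n)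
    yh_pi_is_monoid_morphism.

Definition yh_t i : YH0 K r n := @yh_pi K r n (free_t K i).
Definition yh_g i : YH0 K r n := @yh_pi K r n (free_g K i).

Lemma yh_t_order i : yh_t i ^+ r = 1.
Proof.
rewrite /yh_t -rmorphXn -[RHS](rmorph1 (@yh_pi K r n)).
exact: alg_quot_rel (YH_t_order K r i).
Qed.

Lemma yh_t_comm i j : GRing.comm (yh_t i) (yh_t j).
Proof. exact: (alg_quot_relM (YH_t_comm K r i j)). Qed.

Lemma yh_g_t i j : yh_g i * yh_t j = yh_t (tperm (posl i) (posr i) j) * yh_g i.
Proof. exact: alg_quot_relM (YH_g_t K r i j). Qed.

Lemma yh_g_comm (i j : 'I_n.-1) : (i + 2 <= j)%N -> GRing.comm (yh_g i) (yh_g j).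
Proof.
move=> ij; have ij' : (i + 2 <= j)%N || (j + 2 <= i)%N by rewrite ij.
exact: alg_quot_relM (YH_g_comm K r ij').
Qed.

Lemma yh_g_braid (i j : 'I_n.-1) : j = i.+1 :> nat ->
  yh_g i * yh_g j * yh_g i = yh_g j * yh_g i * yh_g j.
Proof. by move=> ij; exact: alg_quot_relM3 (YH_g_braid K r ij). Qed.

Lemma yh_g_quad i : yh_g i ^+ 2 = - (yh_idempotent r yh_t i * yh_g i).
Proof.
exact: (lrmorph_quad (f := @yh_pi K r n) (alg_quot_rel (YH_g_quad K r i))).
Qed.

Lemma yh_ind (P : YH0 K r n -> Prop) :
    P 1 -> (forall a b, P a -> P b -> P (a + b)) ->
    (forall k a, P a -> P (k *: a)) -> (forall a b, P a -> P b -> P (a * b)) ->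
    (forall i, P (yh_t i)) -> (forall i, P (yh_g i)) ->
  forall a, P a.
Proof.
move=> P1 PD PZ PM Pt Pg; elim/alg_quot_ind; apply: free_ind.
- exact: P1.
- by move=> a b Pa Pb; rewrite alg_quot_piD; exact: PD.
- by move=> k a Pa; rewrite alg_quot_piZ; exact: PZ.
- by move=> a b Pa Pb; rewrite alg_quot_piM; exact: PM.
- by case=> i; [exact: Pt | exact: Pg].
Qed.

Lemma yh_character (phi : 'I_n -> K) (gamma : 'I_n.-1 -> K) :
    (forall i, phi i ^+ r = 1) ->
    (forall i j,
       gamma i * phi j = phi (tperm (posl i) (posr i) j) * gamma i) ->
    (forall i j, gamma i * gamma j * gamma i = gamma j * gamma i * gamma j) ->
    (forall i, gamma i ^+ 2 = - (r%:R^-1 *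
       (\sum_(0 <= s < r) phi (posl i) ^+ s * phi (posr i) ^+ (r - s))
       * gamma i)) ->
  exists chi : {lrmorphism YH0 K r n -> K^o},
    (forall i, chi (yh_t i) = phi i) /\ (forall i, chi (yh_g i) = gamma i).
Proof.
move=> phi_r gamma_phi gamma_braid gamma_quad.
have [f f_gen] := @free_character K ('I_n + 'I_n.-1)%type
  (fun x => match x with inl i => phi i | inr i => gamma i end).
have ft i : f (free_t K i) = phi i by exact: f_gen.
have fg i : f (free_g K i) = gamma i by exact: f_gen.
have fS x : @yh_relator K r n x -> f x = 0.
  case=> [i|i j|i j|i j _|i j _|i].
  - by apply: character_relX; rewrite ft.
  - by apply: character_relM; rewrite mulrC.
  - by apply: character_relM; rewrite !ft fg.
  - by apply: character_relM; rewrite mulrC.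
  - by apply: character_relM3; rewrite !fg.
  - by apply: character_rel_quad; rewrite !ft fg.
have [h [h_pi h_lin h_mul]] := alg_quot_lift fS.
have hlin : linear (h : YH0 K r n -> K^o) by exact: h_lin.
have hmul : monoid_morphism (h : YH0 K r n -> K^o).
  by split; [exact: etrans (h_pi 1) (rmorph1 f) | exact: h_mul].
pose hL := GRing.isLinear.Build K (YH0 K r n) K^o _ h hlin.
pose hM := GRing.isMonoidMorphism.Build (YH0 K r n) K^o h hmul.
exists (HB.pack h hL hM : {lrmorphism YH0 K r n -> K^o}).
by split=> i; [exact: etrans (h_pi _) (ft i) | exact: etrans (h_pi _) (fg i)].
Qed.
End Presentation.

Theorem theorem2p5 (K : closedFieldType) (r n : nat)
    (r_gt0 : (0 < r)%N) (n_gt0 : (0 < n)%N)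
    (charK : forall p : nat, p \in [pchar K] -> ~~ (p %| r)%N) :
  (forall M : lmodType (YH0 K r n), simple_module M -> has_dim M 1) /\
  (exists L : yh_index r n -> lmodType (YH0 K r n),
    [/\ forall x, simple_module (L x),
        forall x y, module_iso (L x) (L y) -> x = y
      & forall M : lmodType (YH0 K r n), simple_module M ->
          exists x, module_iso M (L x)]).
Proof.
have r0 : r%:R != 0 :> K.
  apply/negP => r_eq0; have [p pK] := natf0_pchar r_gt0 r_eq0.
  by have := charK p pK; rewrite (dvdn_pcharf pK) r_eq0.
have [z z_prim] := closed_prim_root r_gt0 r0.
apply: (simple_classification (t := @yh_t K r n) (g := @yh_g K r n)
  _ r_gt0 r0 z_prim).
split.
- exact: yh_t_order.
- exact: yh_t_comm.
- exact: yh_g_t.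
- exact: yh_g_comm.
- exact: yh_g_braid.
- exact: yh_g_quad.
- exact: yh_ind.
- exact: yh_character.
Qed.
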